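(* Pick $M$ prime, and let $\Phi$ be the $M\times M^2$ frame of all powers and modulates of the chirp function $h_M$. Then $\Phi$ is a unit norm tight frame with $\|\Phi\|_2=\sqrt M$, and has worst-case coherence $\mu=\frac1{\sqrt M}$ and average coherence $\nu\le\frac{\mu}{\sqrt M}$.
   Context: The chirp function $h_M:\mathbb Z_M\to\mathbb C$ is $h_M(t):=e^{\pi\mathrm it(t-M)/M}$, $t\in\mathbb Z_M$ (evaluated at representatives $t=0,\dots,M-1$). The $M^2$ columns of $\Phi$ are the vectors $h_{ab}\in\mathbb C^M$, $a,b\in\{0,\dots,M-1\}$, with entries $h_{ab}(t):=\frac1{\sqrt M}h_M(t)^ae^{2\pi\mathrm ibt/M}$, $t\in\mathbb Z_M$. A unit norm tight frame is a full-rank matrix with unit-norm columns whose rows are pairwise orthogonal with equal norms; $\|\Phi\|_2$ is the spectral norm. For a matrix with $N$ unit-norm columns $\varphi_1,\dots,\varphi_N$ (here $N=M^2$), the worst-case coherence is $\mu:=\max_{i\ne j}|\langle\varphi_i,\varphi_j\rangle|$ and the average coherence is $\nu:=\max_i\left|\frac1{N-1}\sum_{j\ne i}\langle\varphi_i,\varphi_j\rangle\right|$. *)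

(* Defs.v *)
From HB Require Import structures.
From mathcomp Require Import all_boot all_order all_algebra.
From mathcomp Require Import complex.
From mathcomp Require Import boolp classical_sets reals trigo.
Set Implicit Arguments.
Unset Strict Implicit.
Unset Printing Implicit Defensive.
Import Order.TTheory GRing.Theory Num.Theory.
Local Open Scope ring_scope.
Local Open Scope complex_scope.
Local Open Scope classical_set_scope.

(* [expi x] is e^(i x). *)
Definition expi (R : realType) (x : R) : R[i] := cos x +i* sin x.

Section Frames.
Variable R : realType.

(* [dotmx u v] is the Hermitian product \sum_k u_k * (v_k)^* of row vectors.
   The built-in norm `|A| of a matrix is not used: it is the entrywise maximum. *)
Definition l2norm (n : nat) (u : 'rV[R[i]]_n) : R :=
  Num.sqrt (complex.Re (dotmx u u)).

Definition spectral_norm (m n : nat) (A : 'M[R[i]]_(m, n)) : R :=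
  sup [set l2norm (A *m x)^T | x in [set x : 'cV[R[i]]_n | l2norm x^T <= 1]].

Section Coherence.
Variables m n : nat.
Implicit Types (A : 'M[R[i]]_(m, n)).

Definition dotcol A (i j : 'I_n) : R[i] := dotmx (col i A)^T (col j A)^T.

Definition unit_norm_tight_frame A : Prop :=
  [/\ \rank A = minn m n,
      forall j : 'I_n, l2norm (col j A)^T = 1,
      forall i k : 'I_m, i != k -> dotmx (row i A) (row k A) = 0
    & forall i k : 'I_m, l2norm (row i A) = l2norm (row k A)].

(* All the maxima are over nonnegative reals, so 0 is a neutral start value. *)
Definition worst_case_coherence A : R :=
  \big[Num.max/0]_(i < n) \big[Num.max/0]_(j < n | j != i)
    ComplexField.Normc.normc (dotcol A i j).

Definition average_coherence A : R :=
  \big[Num.max/0]_(i < n)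
    ComplexField.Normc.normc
      ((n%:R - 1)^-1 * \sum_(j < n | j != i) dotcol A i j).

End Coherence.

Definition chirp (M : nat) (t : 'I_M) : R[i] :=
  expi (pi * t%:R * (t%:R - M%:R) / M%:R).

Definition chirp_vec (M : nat) (a b t : 'I_M) : R[i] :=
  ((Num.sqrt M%:R)^-1)%:C * chirp t ^+ a * expi (2 * pi * b%:R * t%:R / M%:R).

(* The column of index [mxvec_index a b] is the vector h_ab. *)
Definition chirp_frame (M : nat) : 'M[R[i]]_(M, M * M) :=
  \matrix_(t < M) mxvec (\matrix_(a < M, b < M) chirp_vec a b t).

End Frames.

(* Main.v *)
Require Import Defs.
From mathcomp Require Import all_boot all_order all_algebra.
From mathcomp Require Import complex.
From mathcomp Require Import boolp classical_sets reals trigo.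
From mathcomp Require Import zify ring lra.
Set Implicit Arguments.
Unset Strict Implicit.
Unset Printing Implicit Defensive.
Import Order.TTheory GRing.Theory Num.Theory.
Local Open Scope ring_scope.

(** Put z = e^(i pi/M), so that z^2 is a primitive M-th root of unity. The entry
    of the frame in row t and column (a, b) is z^(a t (t - M) + 2 b t) / sqrt M,
    with an integer exponent, so every quantity of the theorem is a finite sum
    of powers of z.

    Tightness. In the inner product of the rows t and s, the sum over the
    modulation b is a sum of powers of z^(2 (t - s)), which vanishes unless
    t = s; hence Phi Phi^* = M I ([chirp_frame_tight]). This identity alone gives
    the rank, the orthogonality of the rows and the spectral norm sqrt M
    ([spectral_norm_tight]): the bound is the nonnegativity of the squared norm
    of x - Phi^* Phi x / M, and it is attained at the columns of Phi^* / sqrt M.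

    Worst-case coherence. Columns with the same power a are orthogonal, by the
    same geometric sums. For different powers, the inner product is 1/M times a
    quadratic Gauss sum. Its summand is M-periodic (t (t - M) changes by the even
    multiple 2 t M of M under a shift by M), so the squared modulus can be
    expanded along the differences u of two summation indices; the exponent then
    becomes linear in the remaining index, and since a - a' is prime to M only
    u = 0 survives. So the squared modulus of the Gauss sum is M
    ([sqr_norm_chirp_sum]), and the coherence is 1 / sqrt M. This treats M = 2
    together with the odd primes.

    Average coherence. The row t = 0 is constant, so by tightness the sum of all
    columns is supported on that row, and the inner products of a column with all
    the columns add up to M ([sum_dotmx_col_tight]). Without the diagonal term 1,
    the average is (M - 1) / (M^2 - 1) = 1 / (M + 1) < 1 / M. *)

(** * Sums of roots of unity *)

Lemma sum_periodic_shift (V : zmodType) (M : nat) (F : nat -> V) (u : nat) :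
  (forall t, F (t + M)%N = F t) -> \sum_(t < M) F (t + u)%N = \sum_(t < M) F t.
Proof.
move=> FM; elim: u => [|u IHu]; first by apply: eq_bigr => t _; rewrite addn0.
rewrite -IHu -(big_mkord xpredT (fun t => F (t + u.+1)%N)).
rewrite -(big_mkord xpredT (fun t => F (t + u)%N)).
apply: (addrI (F u)).
have -> : F u + \sum_(0 <= t < M) F (t + u.+1)%N = \sum_(0 <= t < M.+1) F (t + u)%N.
  rewrite big_nat_recl //= add0n; congr (_ + _).
  by apply: eq_bigr => t _; rewrite addnS.
by rewrite big_nat_recr //= addnC addrC FM.
Qed.

Lemma prim_exprz_eq1 (F : fieldType) (M : nat) (w : F) (k : int) :
  M.-primitive_root w -> (w ^ k == 1) = (M %| `|k|)%N.
Proof.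
move=> wM; case: k => n; rewrite ?NegzE ?abszN absz_nat -?exprnP.
  by rewrite (prim_order_dvd wM).
by rewrite -exprnN invr_eq1 (prim_order_dvd wM).
Qed.

Lemma sum_prim_exprz (F : fieldType) (M : nat) (w : F) (k : int) :
  M.-primitive_root w ->
  \sum_(t < M) (w ^ k) ^+ t = if (M %| `|k|)%N then M%:R else 0.
Proof.
move=> wM; rewrite -(prim_exprz_eq1 k wM); case: eqP => [-> | /eqP wk1].
  by rewrite (eq_bigr (fun=> 1)) ?sumr_const ?card_ord // => t _; rewrite expr1n.
have /eqP : (w ^ k - 1) * \sum_(t < M) (w ^ k) ^+ t = 0.
  by rewrite -subrX1 exprnP exprzAC -exprnP (prim_expr_order wM) exp1rz subrr.
by rewrite mulf_eq0 subr_eq0 (negPf wk1) => /eqP.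
Qed.

Lemma exprz_sqr_exprn (F : fieldType) (z : F) (k : int) (n : nat) :
  ((z ^+ 2) ^ k) ^+ n = z ^ (2 * k * n%:Z).
Proof. by rewrite -exprz_exp -exprz_exp. Qed.

Lemma conj_exprz (C : numClosedFieldType) (z : C) (k : int) :
  `|z| = 1 -> (z ^ k)^* = z ^ (- k).
Proof. by move=> z1; rewrite fmorphXz -exprz_inv invC_norm z1 expr1n invr1 mul1r. Qed.

(** With F the M-periodic summand, the squared modulus is the sum over s and u of
    F (s + u) (F s)^* = F u * z^(2 c u s): the quadratic term in s cancels. Summing
    over s first leaves a full geometric sum, which is zero unless M divides u. *)
Lemma sqr_norm_chirp_sum (C : numClosedFieldType) (M : nat) (z : C) (c d : int) :
  `|z| = 1 -> M.-primitive_root (z ^+ 2) -> coprime M `|c| ->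
  `|\sum_(t < M) z ^ (c * (t%:Z * (t%:Z - M%:Z)) + 2 * d * t%:Z)| ^+ 2 = M%:R.
Proof.
move=> z1 wM cM.
have z0 : z != 0 by rewrite -normr_eq0 z1 oner_eq0.
pose q (t : nat) : int := c * (t%:Z * (t%:Z - M%:Z)) + 2 * d * t%:Z.
have zM2 (k : int) : z ^ (2 * k * M%:Z) = 1.
  by rewrite -exprz_sqr_exprn exprnP exprzAC -exprnP (prim_expr_order wM) exp1rz.
have qM (t : nat) : z ^ q (t + M)%N = z ^ q t.
  have -> : q (t + M)%N = q t + 2 * (c * t%:Z + d) * M%:Z by rewrite /q PoszD; ring.
  by rewrite expfzDr // zM2 mulr1.
have qB (u s : nat) :
    z ^ q (u + s)%N * (z ^ q s)^* = z ^ q u * ((z ^+ 2) ^ (c * u%:Z)) ^+ s.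
  rewrite conj_exprz // exprz_sqr_exprn -!expfzDr //.
  by congr (_ ^ _); rewrite /q PoszD; ring.
rewrite normCK rmorph_sum /= mulr_sumr.
transitivity (\sum_(u < M) z ^ q u * \sum_(s < M) ((z ^+ 2) ^ (c * u%:Z)) ^+ s).
  under [RHS]eq_bigr do rewrite mulr_sumr.
  rewrite exchange_big; apply: eq_bigr => s _ /=.
  rewrite -/(q _) -[X in X * _](sum_periodic_shift (F := fun t => z ^ q t) s qM).
  by rewrite mulr_suml; apply: eq_bigr => u _; rewrite qB.
have M_gt0 := prim_order_gt0 wM.
(* Only the difference u = 0 contributes, and it gives the number of indices s. *)
rewrite (bigD1 (Ordinal M_gt0)) //= [X in _ + X]big1 => [|u u0].
  by rewrite sum_prim_exprz // mulr0 dvdn0 /q !(mul0r, mulr0) addr0 mul1r.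
rewrite sum_prim_exprz // abszM absz_nat Gauss_dvdr // gtnNdvd ?mulr0 //.
by rewrite lt0n; apply: contra u0 => /eqP u0; apply/eqP/val_inj.
Qed.

(** * Tight frames over a closed field *)

Section TightFrames.
Local Open Scope sesquilinear_scope.

Lemma dotmx_mulmxl (C : numClosedFieldType) (m n : nat)
    (u : 'rV[C]_m) (v : 'rV[C]_n) (B : 'M[C]_(m, n)) :
  dotmx (u *m B) v = dotmx u (v *m B ^t*).
Proof. by rewrite !dotmxE trmx_mul map_mxM mulmxA -map_trmx trmxCK. Qed.

(** Bessel inequality, from the nonnegativity of the squared norm of the residual
    u - (u B) B^* / a^2. Vectors are rows here, so B is the transpose of the frame
    matrix. *)
Lemma dotmx_tight_le (C : numClosedFieldType) (m n : nat) (a : C)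
    (B : 'M[C]_(n, m)) (u : 'rV[C]_n) :
  0 < a -> B ^t* *m B = (a ^+ 2)%:M ->
  dotmx (u *m B) (u *m B) <= a ^+ 2 * dotmx u u.
Proof.
move=> a_gt0 BB; set y := u *m B.
have aJ : (a ^- 2)^* = a ^- 2 by rewrite conj_Creal // rpredV rpredX // gtr0_real.
have a0 : a != 0 by rewrite gt_eqF.
have yy_real : (dotmx y y)^* = dotmx y y by rewrite conj_Creal // ger0_real // dnorm_ge0.
have := dnorm_ge0 (@dotmx C n) (u - a ^- 2 *: (y *m B ^t*)).
rewrite dnormB dnormZ linearZr_LR /=.
have -> : dotmx u (y *m B ^t*) = dotmx y y by rewrite -dotmx_mulmxl.
have -> : dotmx (y *m B ^t*) (y *m B ^t*) = a ^+ 2 * dotmx y y.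
  by rewrite -dotmx_mulmxl -mulmxA BB mul_mx_scalar linearZl_LR.
rewrite normCK !aJ rmorphM /= aJ yy_real.
have -> : dotmx u u + a ^- 2 * a ^- 2 * (a ^+ 2 * dotmx y y)
   - (a ^- 2 * dotmx y y + a ^- 2 * dotmx y y) = dotmx u u - a ^- 2 * dotmx y y.
  by field.
by rewrite subr_ge0 mulrC ler_pdivrMr ?exprn_gt0 // mulrC.
Qed.

Lemma dotmx_tight_attained (C : numClosedFieldType) (m n : nat) (a : C)
    (B : 'M[C]_(n, m)) (e : 'rV[C]_m) :
  0 < a -> B ^t* *m B = (a ^+ 2)%:M -> dotmx e e = 1 ->
  let u := a^-1 *: (e *m B ^t*) in
  dotmx u u = 1 /\ dotmx (u *m B) (u *m B) = a ^+ 2.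
Proof.
move=> a_gt0 BB ee u; have a0 : a != 0 by rewrite gt_eqF.
have a2 : `|a^-1| ^+ 2 = a ^- 2 by rewrite ger0_norm ?exprVn // invr_ge0 ltW.
have uB : u *m B = a *: e.
  by rewrite -scalemxAl -mulmxA BB mul_mx_scalar scalerA expr2 mulKf.
split; last by rewrite uB dnormZ /= ee mulr1 ger0_norm // ltW.
rewrite dnormZ /= -dotmx_mulmxl -mulmxA BB mul_mx_scalar linearZl_LR /= ee a2.
by rewrite mulr1 mulVf // expf_neq0.
Qed.

Lemma mulmx_adjE (C : numClosedFieldType) (m n : nat) (A : 'M[C]_(m, n)) (i k : 'I_m) :
  (A *m A ^t*) i k = \sum_j A i j * (A k j)^*.
Proof. by rewrite mxE; apply: eq_bigr => j _; rewrite !mxE. Qed.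

Lemma mxrank_tight (C : numClosedFieldType) (m n : nat) (A : 'M[C]_(m, n)) (c : C) :
  c != 0 -> A *m A ^t* = c%:M -> \rank A = minn m n.
Proof.
move=> c0 AA.
have AV : A *m (c^-1 *: A ^t*) = 1%:M.
  by rewrite -scalemxAr AA -mul_scalar_mx -scalar_mxM mulVf.
have /eqP -> : row_free A by apply/row_freeP; eexists; exact: AV.
by rewrite (minn_idPl (mulmx1_min AV)).
Qed.

Lemma dotmx_row (C : numClosedFieldType) (m n : nat) (A : 'M[C]_(m, n)) (i k : 'I_m) :
  dotmx (row i A) (row k A) = (A *m A ^t*) i k.
Proof. by rewrite mulmx_adjE dotmxE mxE; apply: eq_bigr => j _; rewrite !mxE. Qed.

Lemma dotmx_col (C : numClosedFieldType) (m n : nat) (A : 'M[C]_(m, n)) (i j : 'I_n) :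
  dotmx (col i A)^T (col j A)^T = \sum_t A t i * (A t j)^*.
Proof. by rewrite dotmxE !mxE; apply: eq_bigr => t _; rewrite !mxE. Qed.

(** Since the row t0 has all its entries equal to k, the sum of the conjugated row t
    is, up to the factor k, the inner product of the rows t0 and t; by orthogonality of the rows the sum of all
    columns is then supported at t0. *)
Lemma sum_dotmx_col_tight (C : numClosedFieldType) (m n : nat)
    (A : 'M[C]_(m, n)) (c k : C) (t0 : 'I_m) (i : 'I_n) :
  A *m A ^t* = c%:M -> k != 0 -> (forall j, A t0 j = k) ->
  \sum_j dotmx (col i A)^T (col j A)^T = c.
Proof.
move=> AA k0 Ak; apply: (mulfI k0).
have row_sum t : k * \sum_j (A t j)^* = c *+ (t0 == t).
  have /matrixP/(_ t0 t) := AA; rewrite !mxE => <-; rewrite mulr_sumr.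
  by apply: eq_bigr => j _; rewrite !mxE Ak.
under eq_bigr do rewrite dotmx_col.
rewrite exchange_big /=; under eq_bigr do rewrite -mulr_sumr.
rewrite mulr_sumr (bigD1 t0) //= [X in _ + X]big1 ?addr0 => [|t tt0];
  rewrite mulrCA row_sum.
  by rewrite eqxx Ak.
by rewrite eq_sym (negPf tt0) mulr0.
Qed.

End TightFrames.

Local Open Scope complex_scope.

(** * Complex exponentials *)

Lemma expiD (R : realType) (x y : R) : expi (x + y) = expi x * expi y.
Proof. by rewrite /expi cosD sinD; simpc; rewrite [sin x * _ + _]addrC. Qed.

Lemma expi0 (R : realType) : expi (0 : R) = 1.
Proof. by rewrite /expi cos0 sin0. Qed.

Lemma expi_pi (R : realType) : expi (pi : R) = -1.
Proof. by rewrite /expi cospi sinpi; simpc. Qed.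

Lemma expi_neq0 (R : realType) (x : R) : expi x != 0.
Proof.
apply/eqP => x0; have /eqP := expi0 R.
by rewrite -(subrr x) expiD x0 mul0r eq_sym oner_eq0.
Qed.

Lemma expiN (R : realType) (x : R) : expi (- x) = (expi x)^-1.
Proof. by apply: (mulfI (expi_neq0 x)); rewrite -expiD subrr expi0 mulfV ?expi_neq0. Qed.

Lemma expi_exprn (R : realType) (x : R) (n : nat) : expi x ^+ n = expi (x * n%:R).
Proof.
elim: n => [|n IHn]; first by rewrite mulr0 expi0.
by rewrite exprS IHn -expiD -[n.+1]add1n natrD mulrDr mulr1.
Qed.

Lemma expi_exprz (R : realType) (x : R) (k : int) : expi x ^ k = expi (x * k%:~R).
Proof.
case: k => n; first by rewrite -exprnP expi_exprn.
by rewrite NegzE -exprnN expi_exprn -expiN mulrNz mulrN.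
Qed.

Lemma norm_expi (R : realType) (x : R) : `|expi x| = 1.
Proof. by rewrite normc_def /= cos2Dsin2 sqrtr1. Qed.

Lemma expi_neq1 (R : realType) (x : R) : 0 < x < pi *+ 2 -> expi x != 1.
Proof.
move=> /andP[x0 x2pi]; apply/eqP => -[cosx1 _].
have : 0 < sin (x / 2) by apply: sin_gt0_pi; lra.
(* cos x = 1 - 2 sin(x/2)^2, and sin(x/2) > 0. *)
have := cos_mulr2n (x / 2); have -> : (x / 2) *+ 2 = x by lra.
rewrite cosx1.
have := cos2Dsin2 (x / 2); nra.
Qed.

Lemma expi_prim_root (R : realType) (M : nat) :
  (0 < M)%N -> M.-primitive_root (expi (pi / M%:R : R) ^+ 2).
Proof.
move=> M_gt0; have M0 : (M%:R : R) != 0 by rewrite pnatr_eq0 -lt0n.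
have MR_gt0 : (0 : R) < M%:R by rewrite ltr0n.
apply/andP; split => //; apply/forallP => i; rewrite unity_rootE expi_exprn expi_exprn.
have [iM|iM] := eqVneq i.+1 M.
  rewrite iM eqb_id.
  have -> : pi / M%:R * 2 * M%:R = pi + pi :> R by field.
  by rewrite expiD expi_pi mulrN1 opprK.
apply/eqP/negbTE/expi_neq1; have iltM : (i.+1 < M)%N by rewrite ltn_neqAle iM ltn_ord.
have := pi_gt0 R => pi0.
rewrite !mulr_gt0 ?invr_gt0 ?ltr0n //=.
have -> : pi / M%:R * 2 * i.+1%:R = (pi *+ 2) * (i.+1%:R / M%:R) :> R.
  by rewrite -mulr_natr; field.
by rewrite gtr_pMr ?ltr_pdivrMr ?mul1r ?ltr_nat // mulrn_wgt0.
Qed.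

(** * Norms of real and complex frames *)

Section RealFrames.
Local Open Scope sesquilinear_scope.

Lemma l2norm_le (R : realType) (n : nat) (u : 'rV[R[i]]_n) (c : R) :
  0 <= c -> (l2norm u <= c) = (dotmx u u <= (c ^+ 2)%:C).
Proof.
move=> c0; have := dnorm_ge0 (@dotmx R[i] n) u.
rewrite /l2norm lecE [in X in _ -> X]lecE /= => /andP[/eqP Im0 _].
by rewrite Im0 eqxx /= -[in LHS](ger0_norm c0) -sqrtr_sqr ler_sqrt ?sqr_ge0.
Qed.

Lemma l2norm_eq (R : realType) (n : nat) (u : 'rV[R[i]]_n) (c : R) :
  0 <= c -> dotmx u u = (c ^+ 2)%:C -> l2norm u = c.
Proof. by move=> c0 uc; rewrite /l2norm uc /= sqrtr_sqr ger0_norm. Qed.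

Lemma spectral_norm_tight (R : realType) (m n : nat) (a : R) (A : 'M[R[i]]_(m, n)) :
  (0 < m)%N -> 0 < a -> A *m A ^t* = ((a ^+ 2)%:C)%:M -> spectral_norm A = a.
Proof.
move=> m_gt0 a_gt0 AA.
have aC_gt0 : 0 < a%:C by rewrite ltcR.
have BB : (A^T) ^t* *m A^T = (a%:C ^+ 2)%:M.
  by rewrite -rmorphXn /= -[LHS]trmxK trmx_mul !trmxK map_trmx AA tr_scalar_mx.
pose E := [set l2norm (A *m x)^T | x in [set x : 'cV[R[i]]_n | l2norm x^T <= 1]]%classic.
have E_le : ubound E a.
  move=> _ [x /= x1 <-]; rewrite trmx_mul l2norm_le ?(ltW a_gt0) //.
  apply: le_trans (dotmx_tight_le _ aC_gt0 BB) _.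
  move: x1; rewrite l2norm_le // expr1n => x1.
  by rewrite -[leRHS]mulr1 rmorphXn /= ler_pM2l ?exprn_gt0.
have E_a : E a.
  pose e : 'rV[R[i]]_m := delta_mx 0 (Ordinal m_gt0).
  have ee : dotmx e e = 1.
    by rewrite dotmxE trmx_delta map_delta_mx mul_delta_mx mxE !eqxx.
  have [uu uBuB] := dotmx_tight_attained aC_gt0 BB ee.
  exists (a%:C^-1 *: (e *m (A^T) ^t*))^T; rewrite /= ?trmx_mul (trmxK (_ *: _)).
    by rewrite l2norm_le // uu expr1n.
  by apply: l2norm_eq; rewrite ?(ltW a_gt0) // uBuB rmorphXn.
apply/eqP; rewrite eq_le ge_sup ?ub_le_sup //; [by exists a|by exists a].
Qed.

Lemma unit_norm_tight_frame_tight (R : realType) (m n : nat)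
    (A : 'M[R[i]]_(m, n)) (c : R[i]) :
  c != 0 -> A *m A ^t* = c%:M -> (forall j, dotcol A j j = 1) ->
  unit_norm_tight_frame A.
Proof.
move=> c0 AA A1; split; first exact: mxrank_tight c0 AA.
- by move=> j; apply: l2norm_eq; rewrite // expr1n; exact: A1.
- by move=> i k ik; rewrite dotmx_row AA mxE (negPf ik).
- by move=> i k; rewrite /l2norm !dotmx_row AA !mxE !eqxx.
Qed.

End RealFrames.

(** * The chirp frame *)

Lemma sum_mxvec_index (V : nmodType) (m n : nat) (F : 'I_(m * n) -> V) :
  \sum_k F k = \sum_a \sum_b F (mxvec_index a b).
Proof.
rewrite pair_bigA (reindex _ (curry_mxvec_bij m n)).
by apply: eq_bigr => -[a b].
Qed.

Lemma mxvec_index_inj (m n : nat) (a a' : 'I_m) (b b' : 'I_n) :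
  mxvec_index a b = mxvec_index a' b' -> (a, b) = (a', b').
Proof. by move=> /cast_ord_inj/enum_rank_inj. Qed.

(** Decides which geometric sums vanish, their exponents being differences of row
    or modulation indices, and, for prime M, that distinct powers differ by a
    number prime to M. *)
Lemma dvdn_abszB_ord (M : nat) (i j : 'I_M) : (M %| `|i%:Z - j%:Z|)%N = (i == j).
Proof.
have [->|ij] := eqVneq i j; first by rewrite subrr dvdn0.
have ijn : i != j :> nat by [].
by rewrite gtnNdvd //; have := ltn_ord i; have := ltn_ord j; lia.
Qed.

Lemma chirp_vecE (R : realType) (M : nat) (a b t : 'I_M) :
  chirp_vec R a b t = ((Num.sqrt M%:R)^-1)%:C *
    expi (pi / M%:R) ^ (a%:Z * (t%:Z * (t%:Z - M%:Z)) + 2 * b%:Z * t%:Z).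
Proof.
rewrite /chirp_vec /chirp expi_exprn -mulrA -expiD expi_exprz; congr (_ * expi _).
rewrite !(intrD, intrM, intrN) -!pmulrn; ring.
Qed.

Lemma chirp_frameE (R : realType) (M : nat) (a b t : 'I_M) :
  chirp_frame R M t (mxvec_index a b) = ((Num.sqrt M%:R)^-1)%:C *
    expi (pi / M%:R) ^ (a%:Z * (t%:Z * (t%:Z - M%:Z)) + 2 * b%:Z * t%:Z).
Proof. by rewrite mxE mxvecE mxE chirp_vecE. Qed.

(** The rows t and t' are kept distinct: t = t' serves inner products of columns,
    and a = a', b = b' inner products of rows. *)
Lemma mul_chirp_frame_conj (R : realType) (M : nat) (a b a' b' t t' : 'I_M) :
  chirp_frame R M t (mxvec_index a b) * ((chirp_frame R M t' (mxvec_index a' b'))^*)%R =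
  M%:R^-1 * expi (pi / M%:R) ^
    (a%:Z * (t%:Z * (t%:Z - M%:Z)) - a'%:Z * (t'%:Z * (t'%:Z - M%:Z)) +
     2 * (b%:Z * t%:Z - b'%:Z * t'%:Z)).
Proof.
have s2 :
    (Num.sqrt (M%:R : R))^-1%:C * ((Num.sqrt (M%:R : R))^-1%:C^*)%R = M%:R^-1 :> R[i].
  rewrite [X in _ * X]conjc_real -rmorphM -invfM -expr2 sqr_sqrtr ?ler0n //.
  by rewrite fmorphV rmorph_nat.
rewrite !chirp_frameE rmorphM /= mulrACA s2.
rewrite conj_exprz ?norm_expi // -expfzDr ?expi_neq0 //.
by congr (_ * _ ^ _); ring.
Qed.

(** For fixed rows t and s the modulations already form a geometric sum in
    z^(2 (t - s)), for each power a separately. *)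
Lemma chirp_frame_tight (R : realType) (M : nat) : (0 < M)%N ->
  (chirp_frame R M *m (chirp_frame R M) ^t*)%sesqui = M%:R%:M.
Proof.
move=> M_gt0; have M0 : M%:R != 0 :> R[i] by rewrite pnatr_eq0 -lt0n.
apply/matrixP => t s; rewrite mulmx_adjE mxE sum_mxvec_index.
set z : R[i] := expi (pi / M%:R).
have wM : M.-primitive_root (z ^+ 2) := expi_prim_root R M_gt0.
pose q (t : 'I_M) : int := t%:Z * (t%:Z - M%:Z).
transitivity (\sum_(a < M) (M%:R^-1 * z ^ (a%:Z * (q t - q s))) *
    \sum_(b < M) ((z ^+ 2) ^ (t%:Z - s%:Z)) ^+ b).
  apply: eq_bigr => a _; rewrite mulr_sumr; apply: eq_bigr => b _.
  rewrite mul_chirp_frame_conj -mulrA; congr (_ * _).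
  rewrite exprz_sqr_exprn -expfzDr ?expi_neq0 //; congr (_ ^ _).
  by rewrite /q; ring.
rewrite sum_prim_exprz // dvdn_abszB_ord; have [->|_] := eqVneq t s; last first.
  by rewrite big1 // => a _; rewrite mulr0.
under eq_bigr do rewrite subrr mulr0 expr0z mulr1 mulVf //.
by rewrite sumr_const card_ord.
Qed.

Lemma dotcol_chirp_frame (R : realType) (M : nat) (a b a' b' : 'I_M) :
  dotcol (chirp_frame R M) (mxvec_index a b) (mxvec_index a' b') =
  M%:R^-1 * \sum_(t < M) expi (pi / M%:R) ^
    ((a%:Z - a'%:Z) * (t%:Z * (t%:Z - M%:Z)) + 2 * (b%:Z - b'%:Z) * t%:Z).
Proof.
rewrite /dotcol dotmx_col mulr_sumr; apply: eq_bigr => t _.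
by rewrite mul_chirp_frame_conj; congr (_ * _ ^ _); ring.
Qed.

Lemma dotcol_chirp_frame_same_power (R : realType) (M : nat) (a b b' : 'I_M) :
  dotcol (chirp_frame R M) (mxvec_index a b) (mxvec_index a b') = (b == b')%:R.
Proof.
have M_gt0 : (0 < M)%N := leq_ltn_trans (leq0n a) (ltn_ord a).
have M0 : M%:R != 0 :> R[i] by rewrite pnatr_eq0 -lt0n.
rewrite dotcol_chirp_frame subrr.
under eq_bigr do rewrite mul0r add0r -exprz_sqr_exprn.
rewrite sum_prim_exprz ?expi_prim_root // dvdn_abszB_ord.
by case: eqP => _; rewrite ?mulr0 // mulVf.
Qed.

Lemma normc_eq (R : realType) (x : R[i]) (r : R) :
  0 <= r -> `|x| ^+ 2 = (r ^+ 2)%:C -> ComplexField.Normc.normc x = r.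
Proof.
move=> r0; case: x => x y; rewrite -add_Re2_Im2 => /complexI /= ->.
by rewrite sqrtr_sqr ger0_norm.
Qed.

(** Primality enters here: it makes the difference of two distinct powers prime
    to M, as the Gauss sum requires. *)
Lemma normc_dotcol_chirp_frame (R : realType) (M : nat) (a b a' b' : 'I_M) :
  prime M -> a != a' ->
  ComplexField.Normc.normc
    (dotcol (chirp_frame R M) (mxvec_index a b) (mxvec_index a' b')) =
  (Num.sqrt M%:R)^-1.
Proof.
move=> M_prime aa'; have M_gt0 := prime_gt0 M_prime.
have sM0 : 0 <= (Num.sqrt (M%:R : R))^-1 by rewrite invr_ge0 sqrtr_ge0.
have M0 : M%:R != 0 :> R[i] by rewrite pnatr_eq0 -lt0n.
rewrite dotcol_chirp_frame; apply: normc_eq => //.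
rewrite normrM exprMn sqr_norm_chirp_sum ?norm_expi ?expi_prim_root //; last first.
  by rewrite prime_coprime // dvdn_abszB_ord.
rewrite exprVn sqr_sqrtr ?ler0n // normfV normr_nat fmorphV rmorph_nat.
by rewrite expr2 -mulrA mulVf // mulr1.
Qed.

Lemma worst_case_coherence_chirp_frame (R : realType) (M : nat) : prime M ->
  worst_case_coherence (chirp_frame R M) = (Num.sqrt M%:R)^-1.
Proof.
move=> M_prime; have s0 : 0 <= (Num.sqrt (M%:R : R))^-1 by rewrite invr_ge0 sqrtr_ge0.
apply/eqP; rewrite eq_le; apply/andP; split.
  apply: bigmax_le => // i _; apply: bigmax_le => // j ji.
  case/mxvec_indexP: i ji => a b; case/mxvec_indexP: j => a' b' ji.
  have [aa'|aa'] := eqVneq a a'; last by rewrite normc_dotcol_chirp_frame.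
  rewrite -aa' dotcol_chirp_frame_same_power.
  have /negPf -> : b != b' by apply: contra_neq ji => ->; rewrite aa'.
  by rewrite ComplexField.Normc.normc0.
(* Any two different powers attain the bound; M > 1 provides 0 and 1. *)
pose o := Ordinal (prime_gt0 M_prime); pose l := Ordinal (prime_gt1 M_prime).
pose i := mxvec_index o o; pose j := mxvec_index l o.
have ji : j != i by apply/eqP => /mxvec_index_inj[].
apply: (bigmax_sup i) => //; apply: (bigmax_sup j) => //.
by rewrite normc_dotcol_chirp_frame.
Qed.

Lemma average_coherence_chirp_frame (R : realType) (M : nat) : (1 < M)%N ->
  average_coherence (chirp_frame R M) <= M.+1%:R^-1.
Proof.
move=> M_gt1; have M_gt0 := ltnW M_gt1.
pose o := Ordinal M_gt0.
have Mp0 : 0 <= (M.+1%:R : R)^-1 by rewrite invr_ge0 ler0n.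
have s0 : (Num.sqrt (M%:R : R))^-1%:C != 0.
  by rewrite fmorph_eq0 invr_eq0 sqrtr_eq0 -ltNge ltr0n.
have row0 k : chirp_frame R M o k = (Num.sqrt (M%:R : R))^-1%:C.
  by case/mxvec_indexP: k => a b; rewrite chirp_frameE !(mul0r, mulr0) addr0 expr0z mulr1.
have avg i : ((M * M)%:R - 1)^-1 * (\sum_(j | j != i) dotcol (chirp_frame R M) i j)
    = (M.+1%:R^-1)%:C.
  have -> : \sum_(j | j != i) dotcol (chirp_frame R M) i j = M%:R - 1.
    rewrite -(sum_dotmx_col_tight i (chirp_frame_tight R M_gt0) s0 row0).
    rewrite [in RHS](bigD1 i) //=.
    have -> : dotmx (col i (chirp_frame R M))^T (col i (chirp_frame R M))^T = 1.
      by case/mxvec_indexP: i => a b; rewrite [LHS]dotcol_chirp_frame_same_power eqxx.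
    by rewrite addrC addrK.
  rewrite fmorphV rmorph_nat natrM -natr1.
  have M1 : M%:R - 1 != 0 :> R[i] by rewrite subr_eq0 pnatr_eq1 gtn_eqF.
  have M2 : M%:R + 1 != 0 :> R[i] by rewrite natr1 pnatr_eq0.
  have -> : M%:R * M%:R - 1 = (M%:R - 1) * (M%:R + 1) :> R[i] by ring.
  by rewrite invfM mulrC mulrA mulfV // mul1r.
apply: bigmax_le => // i _; rewrite avg.
by rewrite (normc_eq Mp0) // normc_def /= expr0n addr0 sqrtr_sqr ger0_norm // rmorphXn.
Qed.

Theorem theorem54 (R : realType) (M : nat) (M_prime : prime M) :
  let Phi := chirp_frame R M in
  let mu := worst_case_coherence Phi in
  let nu := average_coherence Phi in
  [/\ unit_norm_tight_frame Phi,
      spectral_norm Phi = Num.sqrt M%:R,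
      mu = 1 / Num.sqrt M%:R
    & nu <= mu / Num.sqrt M%:R].
Proof.
have M_gt0 := prime_gt0 M_prime.
have MR_gt0 : 0 < M%:R :> R by rewrite ltr0n.
have sM_gt0 : 0 < Num.sqrt M%:R :> R by rewrite sqrtr_gt0.
have tight := chirp_frame_tight R M_gt0.
move=> Phi mu nu; split.
- apply: unit_norm_tight_frame_tight tight _; first by rewrite pnatr_eq0 -lt0n.
  by case/mxvec_indexP => a b; rewrite dotcol_chirp_frame_same_power eqxx.
- by apply: spectral_norm_tight; rewrite // sqr_sqrtr ?ltW // rmorph_nat.
- by rewrite div1r; apply: worst_case_coherence_chirp_frame.
- apply: le_trans (average_coherence_chirp_frame R (prime_gt1 M_prime)) _.
  rewrite /mu worst_case_coherence_chirp_frame // -invfM -expr2 sqr_sqrtr ?ler0n //.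
  by rewrite lef_pV2 ?posrE ?ltr0n // ler_nat.
Qed.
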